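(* Let $\mathcal{G}$ be a connected weighted undirected graph on $V=\{1,\dots,n\}$, let $V_L=\{v_1,\dots,v_m\}\subset V$ be a set of $m$ leader agents, and let $V_{\rm demotion}=\{v_{i_1},\dots,v_{i_r}\}\subset V_L$ be given, with $J=\{i_1,\dots,i_r\}\subset\{1,\dots,m\}$ and $|J|=r$. Consider the leader selection problem: minimize $$f(\tilde V_L):=\|G-\tilde G\|_{H^2}^2$$ over all new leader sets $\tilde V_L=\{\tilde v_l : l\in\{1,\dots,m\}\setminus J\}\subset V\setminus V_{\rm demotion}$ with $|\tilde V_L|=m-|V_{\rm demotion}|$. Then a global optimal solution $\tilde V_L^*$ of this problem is given by $$\tilde V_L^*=V_L\setminus V_{\rm demotion},$$ indexed by $\tilde v_l=v_l$ for $l\in\{1,\dots,m\}\setminus J$.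
   Context: Graph: $\mathcal{G}=(V,E,A)$ is a connected weighted undirected simple graph with vertex set $V=\{1,\dots,n\}$ and symmetric adjacency matrix $A=(a_{ij})$, where $a_{ij}=a_{ji}>0$ if $\{i,j\}$ is an edge and $a_{ij}=0$ otherwise (in particular $a_{ii}=0$). The degree matrix is $D={\rm diag}(d_1,\dots,d_n)$, $d_i=\sum_{j=1}^n a_{ij}$, and the Laplacian is $L=D-A$. Number the edges $1,\dots,k$, let $W={\rm diag}(w_1,\dots,w_k)$ be the diagonal matrix of edge weights, orient each edge arbitrarily, and let $R\in\mathbf{R}^{n\times k}$ be the incidence matrix: $R_{ij}=1$ if vertex $i$ is the source of edge $j$, $R_{ij}=-1$ if vertex $i$ is the sink of edge $j$, and $R_{ij}=0$ otherwise. (Then $L=RWR^T$.) Original system: $V_L=\{v_1,\dots,v_m\}\subset V$ consists of $m$ distinct vertices. $M\in\mathbf{R}^{n\times m}$ has $M_{il}=1$ if $i=v_l$ and $M_{il}=0$ otherwise. The system is $\dot x=-Lx+Mu$, $y=W^{1/2}R^Tx$, with transfer function $G(s)=W^{1/2}R^T(sI_n+L)^{-1}M$. New system: $V_{\rm demotion}=\{v_l: l\in J\}\subset V_L$ is the set of demoted leaders. A new leader set is an indexed set $\tilde V_L=\{\tilde v_l: l\in\{1,\dots,m\}\setminus J\}$ of pairwise distinct vertices of $V\setminus V_{\rm demotion}$. $\tilde M\in\mathbf{R}^{n\times m}$ has $\tilde M_{il}=1$ if $l\notin J$ and $i=\tilde v_l$, and $\tilde M_{il}=0$ otherwise (so the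 columns with index in $J$ are zero). The system is $\dot{\tilde x}=-L\tilde x+\tilde Mu$, $\tilde y=W^{1/2}R^T\tilde x$, with transfer function $\tilde G(s)=W^{1/2}R^T(sI_n+L)^{-1}\tilde M$. The indexing of $\tilde V_L$ determines $\tilde M$, and the minimization is over all such indexed sets. Norm: for a matrix function $H(s)$, $\|H\|_{H^2}=\sqrt{\frac{1}{2\pi}\int_{-\infty}^{\infty}\|H(i\omega)\|_F^2\,d\omega}$, where $\|B\|_F=\sqrt{{\rm tr}(B^\dagger B)}$ is the Frobenius norm and $\dagger$ is Hermitian conjugation (the integrands here are defined for all $\omega\ne0$). *)

(* Defs.v *)
From mathcomp Require Import all_boot all_order all_algebra.
From mathcomp Require Import complex.
From mathcomp Require Import all_classical all_reals all_analysis.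

Set Implicit Arguments.
Unset Strict Implicit.
Unset Printing Implicit Defensive.

Import Order.TTheory GRing.Theory Num.Theory.

Local Open Scope ring_scope.

Section Graph.
Context {R : realType} {n : nat}.
Implicit Type A : 'M[R]_n.

(* The adjacency matrix determines the graph: {i, j} is an edge iff 0 < A i j. *)
Definition adjacency_matrix A : Prop :=
  [/\ A^T = A, (forall i, A i i = 0) & (forall i j, 0 <= A i j)].

Definition adj_rel A : rel 'I_n := fun i j => 0 < A i j.

Definition connected_graph A : Prop := forall i j, connect (adj_rel A) i j.

Definition edges A : {set {set 'I_n}} :=
  [set [set p.1; p.2] | p : 'I_n * 'I_n & adj_rel A p.1 p.2]%SET.

Definition degree_matrix A : 'M[R]_n := diag_mx (\row_i \sum_j A i j).

Definition laplacian A : 'M[R]_n := degree_matrix A - A.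

(* Edge e runs from src e to snk e; every edge has exactly one number and one
   orientation, so that k is the number of edges. *)
Definition oriented_numbering A (k : nat) (src snk : 'I_k -> 'I_n) : Prop :=
  injective (fun e => [set src e; snk e]) /\
  [set [set src e; snk e] | e : 'I_k] = edges A.

Definition incidence_matrix (k : nat) (src snk : 'I_k -> 'I_n) : 'M[R]_(n, k) :=
  \matrix_(i, e) if i == src e then 1 else if i == snk e then -1 else 0.

Definition sqrt_weight_matrix A (k : nat) (src snk : 'I_k -> 'I_n) : 'M[R]_k :=
  diag_mx (\row_e Num.sqrt (A (src e) (snk e))).

End Graph.

Section Leaders.
Context {R : realType} {n m : nat}.

Definition leader_matrix (v : 'I_m -> 'I_n) : 'M[R]_(n, m) :=
  \matrix_(i, l) (i == v l)%:R.

Definition demoted (v : 'I_m -> 'I_n) (J : {set 'I_m}) : {set 'I_n} := v @: J.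

Definition kept (J : {set 'I_m}) : predArgType := {l : 'I_m | l \notin J}.

(* The columns with index in J are zero. *)
Definition new_leader_matrix (J : {set 'I_m}) (vt : kept J -> 'I_n) :
    'M[R]_(n, m) :=
  \matrix_(i, l) if insub l is Some l' then (i == vt l')%:R else 0.

Definition new_leader_set (v : 'I_m -> 'I_n) (J : {set 'I_m})
    (vt : kept J -> 'I_n) : Prop :=
  injective vt /\ forall l, vt l \notin demoted v J.

(* The leaders that are not demoted, with their original indices. *)
Definition remaining_leaders (v : 'I_m -> 'I_n) (J : {set 'I_m}) :
    kept J -> 'I_n :=
  fun l => v (val l).

End Leaders.

Section H2.
Context {R : realType}.

Definition complex_mx (p q : nat) (B : 'M[R]_(p, q)) : 'M[R[i]]_(p, q) :=
  map_mx (real_complex R) B.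

Definition conjtrans (p q : nat) (B : 'M[R[i]]_(p, q)) : 'M[R[i]]_(q, p) :=
  map_mx Num.conj B^T.

(* The trace is a nonnegative real, here an element of R[i]. *)
Definition frobenius (p q : nat) (B : 'M[R[i]]_(p, q)) : R :=
  Num.sqrt (complex.Re (\tr (conjtrans B *m B))).

(* Extended-real valued, so that no integrability is presupposed.  The value of H
   at 0 is irrelevant, {0} being Lebesgue-null. *)
Definition H2norm (p q : nat) (H : R[i] -> 'M[R[i]]_(p, q)) : \bar R :=
  sqrte (((2 * pi)^-1)%:E *
    \int[lebesgue_measure]_w ((frobenius (H (Complex 0 w)) ^+ 2)%:E))%E.

(* The transfer function from u to y = W^{1/2} R^T x of x' = - L x + B u.
   invmx returns its argument on a singular matrix, but s I + L is invertible
   for s = i w with w != 0. *)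
Definition transfer_function (n k m : nat) (A : 'M[R]_n)
    (src snk : 'I_k -> 'I_n) (B : 'M[R]_(n, m)) (s : R[i]) :
    'M[R[i]]_(k, m) :=
  complex_mx (sqrt_weight_matrix A src snk *m (incidence_matrix src snk)^T)
  *m invmx (s%:M + complex_mx (laplacian A)) *m complex_mx B.

Definition demotion_cost (n k m : nat) (A : 'M[R]_n) (src snk : 'I_k -> 'I_n)
    (v : 'I_m -> 'I_n) (J : {set 'I_m}) (vt : kept J -> 'I_n) : \bar R :=
  (H2norm (fun s => transfer_function A src snk (leader_matrix v) s
                    - transfer_function A src snk (new_leader_matrix vt) s)%R
   ^+ 2)%E.

Definition global_minimizer (T : Type) (feasible : T -> Prop) (f : T -> \bar R)
    (x : T) : Prop :=
  feasible x /\ forall y, feasible y -> (f x <= f y)%E.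

End H2.

(* Main.v *)
Require Import Defs.
From mathcomp Require Import all_boot all_order all_algebra.
From mathcomp Require Import complex.
From mathcomp Require Import all_classical all_reals all_analysis.

(** Both systems have the same dynamics and the same output, and differ only
    in their input matrices.  Hence [G - G~ = P (M - M~)], where the factor
    [P = W^{1/2} R^T (s I + L)^-1] does not depend on the new leaders, and
    column [l] of the error is [P] applied to column [l] of [M - M~].

    For [l] in [J] column [l] of [M~] is zero, so column [l] of the error is
    [P M e_l] whatever the new leaders are: demotion has a cost that no choice
    of new leaders can change.  For [l] outside [J] column [l] of the error
    vanishes if [vt l = v l].  Thus keeping the remaining leaders in place
    minimizes the contribution of every column at once, at every frequency:
    each entry of its error matrix is either zero or equal to the corresponding
    entry for any competitor ([demotion_error_le]).

    It remains to see that the [H^2] norm is monotone in the moduli of the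
    entries.  The squared Frobenius norm is the sum of the squared moduli of
    the entries ([mxtrace_conjtrans_mul]), and the integral of nonnegative
    functions is monotone ([le_H2norm]). *)

Import Order.TTheory GRing.Theory Num.Theory.

Local Open Scope ring_scope.

Section Norms.
Context {R : realType} {p q : nat}.

Lemma mxtrace_conjtrans_mul (B : 'M[R[i]]_(p, q)) :
  \tr (conjtrans B *m B) = \sum_j \sum_i `|B i j| ^+ 2.
Proof.
apply: eq_bigr => j _; rewrite mxE; apply: eq_bigr => i _.
by rewrite !mxE mulrC -normCK.
Qed.

Lemma le_frobenius (B C : 'M[R[i]]_(p, q)) :
  (forall i j, `|B i j| <= `|C i j|) -> frobenius B <= frobenius C.
Proof.
move=> leBC; apply: ler_wsqrtr.
have: \tr (conjtrans B *m B) <= \tr (conjtrans C *m C).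
  rewrite !mxtrace_conjtrans_mul.
  by do 2!apply: ler_sum => ? _; rewrite lerXn2r ?nnegrE.
by rewrite lecE => /andP[].
Qed.

(** The integral of a nonnegative function is the supremum of the integrals of
    the simple functions below it, and a larger function has more of them. *)
Lemma le_integral_ge0 {d : measure_display} {T : measurableType d}
    (mu : {measure set T -> \bar R}) (f g : T -> \bar R) :
  (forall x, 0 <= f x)%E -> (forall x, f x <= g x)%E ->
  (\int[mu]_x f x <= \int[mu]_x g x)%E.
Proof.
move=> f0 fg; have g0 x : (0 <= g x)%E := le_trans (f0 x) (fg x).
rewrite !ge0_integralTE//; apply: ereal_sup_le => _ [h /= hf <-].
by exists h => //= x; exact: le_trans (hf x) (fg x).
Qed.

Lemma le_H2norm (F H : R[i] -> 'M[R[i]]_(p, q)) :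
  (forall s i j, `|F s i j| <= `|H s i j|) -> (H2norm F <= H2norm H)%E.
Proof.
move=> leFH.
have c0 : (0 <= ((2 * pi)^-1 : R)%:E)%E.
  by rewrite lee_fin invr_ge0 mulr_ge0 ?pi_ge0.
rewrite /H2norm lee_sqrt; last first.
  by rewrite mule_ge0// integral_ge0// => w _; rewrite lee_fin sqr_ge0.
apply: lee_wpmul2l => //; apply: le_integral_ge0 => w; rewrite lee_fin.
  exact: sqr_ge0.
by rewrite lerXn2r ?nnegrE ?sqrtr_ge0// le_frobenius.
Qed.

End Norms.

Section Demotion.
Context {R : realType} {n k m : nat}.
Variables (A : 'M[R]_n) (src snk : 'I_k -> 'I_n).
Variables (v : 'I_m -> 'I_n) (J : {set 'I_m}).

Lemma transfer_functionB (B C : 'M[R]_(n, m)) (s : R[i]) :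
  transfer_function A src snk B s - transfer_function A src snk C s
  = transfer_function A src snk (B - C) s.
Proof.
by rewrite /transfer_function /complex_mx [map_mx _ (B - C)]raddfB mulmxBr.
Qed.

Lemma transfer_function0 (r : nat) (s : R[i]) :
  transfer_function A src snk (0 : 'M[R]_(n, r)) s = 0.
Proof. by rewrite /transfer_function /complex_mx map_mx0 mulmx0. Qed.

Lemma col_transfer_function (B : 'M[R]_(n, m)) (s : R[i]) (l : 'I_m) :
  col l (transfer_function A src snk B s)
  = transfer_function A src snk (col l B) s.
Proof. by rewrite /transfer_function /complex_mx map_col !colE mulmxA. Qed.

Lemma col_leader_change_demoted (vt vt' : kept J -> 'I_n) (l : 'I_m) :
  l \in J ->
  col l (leader_matrix v - new_leader_matrix vt : 'M[R]_(n, m))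
  = col l (leader_matrix v - new_leader_matrix vt').
Proof.
by move=> lJ; apply/colP => i; rewrite !mxE insubF // lJ.
Qed.

Lemma col_leader_change_remaining (l : 'I_m) :
  l \notin J ->
  col l (leader_matrix v - new_leader_matrix (remaining_leaders v (J := J))
         : 'M[R]_(n, m)) = 0.
Proof.
by move=> lJ; apply/colP => i; rewrite !mxE insubT /remaining_leaders subrr.
Qed.

Definition demotion_error (s : R[i]) (vt : kept J -> 'I_n) : 'M[R[i]]_(k, m) :=
  transfer_function A src snk (leader_matrix v) s
  - transfer_function A src snk (new_leader_matrix vt) s.

(** A column of the error depends on the new leaders only through the same
    column of the change of input matrix, so the bound can be checked column by
    column: equality on [J], and zero on the left outside [J]. *)
Lemma demotion_error_le (vt : kept J -> 'I_n) (s : R[i]) (i : 'I_k)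
    (l : 'I_m) :
  `|demotion_error s (remaining_leaders v (J := J)) i l|
  <= `|demotion_error s vt i l|.
Proof.
have errorE w : `|demotion_error s w i l| = `|transfer_function A src snk
    (col l (leader_matrix v - new_leader_matrix w)) s i 0|.
  by rewrite /demotion_error transfer_functionB -col_transfer_function
             [in RHS]mxE.
rewrite [leLHS]errorE [leRHS]errorE; have [lJ|lJ] := boolP (l \in J).
  by rewrite (col_leader_change_demoted _ vt).
by rewrite col_leader_change_remaining // transfer_function0 mxE normr0.
Qed.

Lemma demotion_cost_remaining_le (vt : kept J -> 'I_n) :
  (demotion_cost A src snk v (remaining_leaders v (J := J))
   <= demotion_cost A src snk v vt)%E.
Proof.
have H2_le : (H2norm (demotion_error ^~ (remaining_leaders v (J := J)))
               <= H2norm (demotion_error ^~ vt))%E.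
  by apply: le_H2norm => s i l; exact: demotion_error_le.
by rewrite /demotion_cost lee_sqr ?sqrte_ge0.
Qed.

(** Injectivity of [v] is what keeps a remaining leader from coinciding with a
    demoted one. *)
Lemma mem_demoted (l : 'I_m) : injective v -> (v l \in demoted v J) = (l \in J).
Proof. by move=> v_inj; rewrite mem_imset. Qed.

Lemma remaining_leaders_feasible :
  injective v -> new_leader_set v (remaining_leaders v (J := J)).
Proof.
move=> v_inj; split=> [l l' /v_inj/val_inj //|l].
by rewrite mem_demoted // (valP l).
Qed.

Lemma remaining_leaders_setD :
  injective v ->
  [set remaining_leaders v l | l : kept J]%SET
    = ([set v l | l : 'I_m] :\: demoted v J)%SET.
Proof.
move=> v_inj; apply/setP => x; rewrite inE; apply/imsetP/andP.
  move=> [l _ ->]; rewrite mem_demoted // (valP l).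
  by rewrite /remaining_leaders imset_f.
move=> [xJ /imsetP[l _ xE]]; move: xJ; rewrite xE mem_demoted // => lJ.
by exists (Sub l lJ).
Qed.

End Demotion.

Theorem theorem1 (R : realType) (n k m : nat) (A : 'M[R]_n)
  (src snk : 'I_k -> 'I_n) (v : 'I_m -> 'I_n) (J : {set 'I_m}) :
  adjacency_matrix A ->
  connected_graph A ->
  oriented_numbering A src snk ->
  injective v ->
  [set remaining_leaders v l | l : kept J]%SET
    = ([set v l | l : 'I_m] :\: demoted v J)%SET /\
  global_minimizer (new_leader_set v (J := J))
    (demotion_cost A src snk v (J := J)) (remaining_leaders v (J := J)).
Proof.
move=> _ _ _ v_inj; split; first exact: remaining_leaders_setD.
split; first exact: remaining_leaders_feasible.
by move=> vt _; exact: demotion_cost_remaining_le.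
Qed.
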